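(* Let $\lambda\in\mathbb{R}$ and let $n\geq 0$ be an integer. Then for every real $x\neq 0$, \[ \frac{1}{x}\,\phi_{n+1,\lambda}(x)=\phi_{n,\lambda}'(x)+\phi_{n,\lambda}(x)-n\lambda\sum_{k=0}^{n-1}\binom{n-1}{k}\phi_{k,\lambda}(x)\,(1)_{n-k,\lambda}, \] where $\phi_{n,\lambda}'(x)=\frac{d}{dx}\phi_{n,\lambda}(x)$.
   Context: For $\lambda\in\mathbb{R}$, the generalized falling factorials are $(x)_{0,\lambda}=1$ and $(x)_{n,\lambda}=x(x-\lambda)(x-2\lambda)\cdots(x-(n-1)\lambda)$ for $n\ge 1$. The degenerate exponential is the formal power series $e_\lambda(t)=\sum_{n\ge 0}(1)_{n,\lambda}\frac{t^n}{n!}$. The degenerate Bell polynomials $\phi_{n,\lambda}(x)$ are defined by the generating function $e^{x(e_\lambda(t)-1)}=\sum_{n=0}^{\infty}\phi_{n,\lambda}(x)\frac{t^n}{n!}$ (as formal power series in $t$). An empty sum is $0$. *)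

(* Defs.v *)
From mathcomp Require Export all_boot all_order all_algebra.
From mathcomp Require Export reals normedtype derive.
From mathcomp Require Import zify.

Set Implicit Arguments.
Unset Strict Implicit.
Unset Printing Implicit Defensive.
Import Order.TTheory GRing.Theory Num.Theory.
Local Open Scope ring_scope.

(* A formal power series in t is its coefficient sequence: f n = [t^n] f.
   A plain function type is used, with its own product, because the
   library's ring structure on functions is the pointwise one. *)
Definition fps (A : Type) : Type := nat -> A.

Definition fps_one (A : pzRingType) : fps A := fun n => (n == 0%N)%:R.

Definition fps_sub (A : pzRingType) (f g : fps A) : fps A :=
  fun n => f n - g n.

Definition fps_scale (A : pzRingType) (a : A) (f : fps A) : fps A :=
  fun n => a * f n.

Definition fps_mul (A : pzRingType) (f g : fps A) : fps A :=
  fun n => \sum_(i < n.+1) f i * g (n - i)%N.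

Definition fps_pow (A : pzRingType) (f : fps A) (k : nat) : fps A :=
  iter k (fps_mul f) (fps_one A).

(* e^f = \sum_k f^k / k!, meaningful when f has zero constant term. Then
   [t^n] f^k = 0 for k > n (fps_pow_eq0 below), so stopping at k = n loses
   nothing. *)
Definition fps_exp (F : fieldType) (A : lalgType F) (f : fps A) : fps A :=
  fun n => \sum_(k < n.+1) (k`!%:R : F)^-1 *: fps_pow f k n.

Lemma fps_pow_eq0 (A : pzRingType) (f : fps A) (k n : nat) :
  f 0%N = 0 -> (n < k)%N -> fps_pow f k n = 0.
Proof.
move=> f0; elim: k n => [//|k IHk] n ltnk.
rewrite /fps_pow iterS /fps_mul big1 // => -[[|i] lei] _ /=.
  by rewrite f0 mul0r.
by rewrite -/(fps_pow f k) IHk ?mulr0 //; lia.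
Qed.

(* (x)_{n,lam} *)
Definition dffact (R : pzRingType) (lam x : R) (n : nat) : R :=
  \prod_(i < n) (x - i%:R * lam).

(* e_lam(t) *)
Definition dexp (F : fieldType) (lam : F) : fps F :=
  fun n => dffact lam 1 n / n`!%:R.

(* e^{x (e_lam(t) - 1)} in F[x][[t]]; the variable x is 'X *)
Definition dbell_gf (F : fieldType) (lam : F) : fps {poly F} :=
  fps_exp (fps_scale 'X
    (fps_sub (fun n => (dexp lam n)%:P) (fps_one {poly F}))).

(* phi_{n,lam}, as a polynomial in x *)
Definition dbell (F : fieldType) (lam : F) (n : nat) : {poly F} :=
  n`!%:R *: dbell_gf lam n.

Lemma dbell_gfE (R : numFieldType) (lam : R) (n : nat) :
  dbell_gf lam n = n`!%:R^-1 *: dbell lam n.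
Proof.
by rewrite /dbell scalerA mulVf ?scale1r // pnatr_eq0 -lt0n fact_gt0.
Qed.

Lemma dbell_gf_arg0 (F : fieldType) (lam : F) :
  fps_scale 'X (fps_sub (fun n => (dexp lam n)%:P) (fps_one {poly F})) 0%N = 0.
Proof.
by rewrite /fps_scale /fps_sub /fps_one /dexp /dffact big_ord0 divr1 subrr mulr0.
Qed.

(* Main.v *)
(* Write F(x, t) = e^{x (e_lam(t) - 1)}.  Then dF/dx = (e_lam - 1) F and
   dF/dt = x e_lam' F, while e_lam = e_lam' + lam t e_lam'.  Comparing the
   coefficients of t^n in
     x^-1 dF/dt = dF/dx + F - lam t e_lam' F
   gives the identity. *)
Require Import Defs.
From mathcomp Require Import all_boot all_order all_algebra.
From mathcomp Require Import reals normedtype derive.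
From mathcomp Require Import ring.
Import Order.TTheory GRing.Theory Num.Theory.
Import numFieldNormedType.Exports.
Local Open Scope ring_scope.

(** The coefficient of t^n in a power involves only coefficients of [f] up to n, so truncation at
    any [N > n] is harmless. This gives access to polynomial calculus. *)
Lemma fps_pow_poly (A : nzRingType) (f : fps A) (N k n : nat) :
  (n < N)%N -> fps_pow f k n = ((\poly_(i < N) f i) ^+ k)`_n.
Proof.
elim: k n => [|k IHk] n ltnN; first by rewrite expr0 coef1.
rewrite exprS coefM /fps_pow iterS /fps_mul; apply: eq_bigr => i _.
rewrite coef_poly (leq_ltn_trans _ ltnN) ?leq_ord // -IHk //.
exact: leq_ltn_trans (leq_subr _ _) ltnN.
Qed.

Lemma fps_powS_deriv (A : comNzRingType) (f : fps A) (k n : nat) :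
  fps_pow f k.+1 n.+1 *+ n.+1 =
  (\sum_(i < n.+1) f i.+1 *+ i.+1 * fps_pow f k (n - i)%N) *+ k.+1.
Proof.
(* Powers of f modulo t^(n+2) are powers of a polynomial, where deriv_exp applies. *)
rewrite (@fps_pow_poly _ f n.+2) // -coef_deriv deriv_exp /= coefMn.
congr (_ *+ _); rewrite coefM; apply: eq_bigr => i _.
rewrite coef_deriv coef_poly ltnS ltn_ord -fps_pow_poly //.
by rewrite ltnS (leq_trans (leq_subr _ _)).
Qed.

(** The coefficients of [f] are constant in x, so the k-th power contributes to x^k alone; this
    separates x from t. *)
Lemma fps_pow_scaleX (A : comNzRingType) (f : fps A) (k n : nat) :
  fps_pow (fps_scale 'X (fun i => (f i)%:P)) k n = fps_pow f k n *: 'X^k.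
Proof.
elim: k n => [|k IHk] n.
  by rewrite expr0 alg_polyC /fps_pow /= /fps_one polyC_natr.
rewrite /fps_pow !iterS /fps_mul scaler_suml; apply: eq_bigr => i _.
rewrite -/(fps_pow _ k) IHk /fps_scale -!mul_polyC polyCM exprS.
by rewrite -/(fps_pow f k); ring.
Qed.

Lemma dexp0 (F : fieldType) (lam : F) : dexp lam 0 = 1.
Proof. by rewrite /dexp /dffact big_ord0 divr1. Qed.

Lemma dexp_fact (F : numFieldType) (lam : F) (n : nat) :
  n`!%:R * dexp lam n = dffact lam 1 n.
Proof. by rewrite /dexp mulrC divfK // pnatr_eq0 -lt0n fact_gt0. Qed.

(* (1 + lam t) e_lam'(t) = e_lam(t) *)
Lemma dexp_ode (F : numFieldType) (lam : F) (n : nat) :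
  dexp lam n.+1 *+ n.+1 = dexp lam n - n%:R * lam * dexp lam n.
Proof.
rewrite /dexp /dffact big_ord_recr /= factS natrM -mulr_natr.
by field; rewrite addrC natr1 !pnatr_eq0 -lt0n fact_gt0.
Qed.

Notation dexp_sub1 lam := (fps_sub (dexp lam) (fps_one _)).

(** With g = e_lam - 1, the coefficient of x^k in e^(x g) is g^k / k!. Both derivative formulas
    thereby become statements about powers of one scalar series. *)
Lemma coef_dbell_gf (F : fieldType) (lam : F) (n k : nat) :
  (dbell_gf lam n)`_k = k`!%:R^-1 * fps_pow (dexp_sub1 lam) k n.
Proof.
have g0 : dexp_sub1 lam 0%N = 0 by rewrite /fps_sub dexp0 subrr.
have gP : fps_sub (fun i => (dexp lam i)%:P) (fps_one {poly F})
          = fun i => (dexp_sub1 lam i)%:P.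
  by apply: boolp.funext => i; rewrite /fps_sub /fps_one polyCB polyC_natr.
rewrite /dbell_gf gP /fps_exp coef_sum.
under eq_bigr => i _ do rewrite fps_pow_scaleX !coefZ coefXn.
have [ltkn|lenk] := ltnP k n.+1.
  rewrite (bigD1 (Ordinal ltkn)) //= eqxx mulr1 big1 ?addr0 // => i.
  by rewrite -val_eqE /= eq_sym => /negPf->; rewrite !mulr0.
(* For k > n the truncated sum never reaches x^k, and g^k has no t^n term because g has zero
   constant term. *)
rewrite fps_pow_eq0 // mulr0 big1 // => i _.
by rewrite gtn_eqF ?mulr0 // (leq_trans (ltn_ord i)).
Qed.

(** In each power of x this is (k+1) g^(k+1) / (k+1)! = g * g^k / k!, with g = e_lam - 1. *)
Lemma dbell_gf_deriv_x (F : numFieldType) (lam : F) (n : nat) :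
  (dbell_gf lam n)^`() + dbell_gf lam n =
  \sum_(i < n.+1) dexp lam i *: dbell_gf lam (n - i)%N.
Proof.
apply/polyP => k; rewrite coefD coef_deriv [RHS]coef_sum.
have -> : (dbell_gf lam n)`_k.+1 *+ k.+1 =
    \sum_(i < n.+1) dexp_sub1 lam i * (dbell_gf lam (n - i)%N)`_k.
  rewrite coef_dbell_gf /fps_pow iterS -/(fps_pow _ k) /fps_mul.
  rewrite -[LHS]mulr_natr mulr_sumr mulr_suml.
  apply: eq_bigr => i _; rewrite coef_dbell_gf factS natrM.
  field; by rewrite addrC natr1 !pnatr_eq0 -lt0n fact_gt0.
(* The series g and e_lam differ only at index 0, where passing from 0 to 1 accounts for the added
   [dbell_gf lam n]. *)
rewrite !big_ord_recl /= /fps_sub /fps_one dexp0 subrr mul0r add0r subn0.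
rewrite scale1r addrC; congr (_ + _); apply: eq_bigr => i _.
by rewrite subr0 coefZ.
Qed.

Lemma dbell_gf_deriv_t (F : numFieldType) (lam : F) (n : nat) :
  dbell_gf lam n.+1 *+ n.+1 =
  'X * \sum_(i < n.+1) (dexp lam i.+1 *+ i.+1) *: dbell_gf lam (n - i)%N.
Proof.
(* The factor ['X] forces the x^0 coefficient to vanish; on the left this is g^0 = 1 having no
   t^(n+1) term. The other coefficients follow from the power rule for g^(k+1). *)
apply/polyP => -[|k]; rewrite coefMn coefXM /=.
  by rewrite coef_dbell_gf /fps_pow /fps_one mulr0 mul0rn.
rewrite coef_dbell_gf -mulrnAr fps_powS_deriv [RHS]coef_sum mulrnAr -[LHS]mulr_natr.
rewrite mulr_sumr mulr_suml; apply: eq_bigr => i _.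
rewrite coefZ coef_dbell_gf /fps_sub /fps_one subr0 factS natrM.
field; by rewrite addrC natr1 !pnatr_eq0 -lt0n fact_gt0.
Qed.

(** Passage from power series coefficients to binomial form: n! (n-k) / (k! (n-k)!) = n C(n-1,
    k). *)
Lemma dexp_dbell_coef (F : numFieldType) (lam x : F) (n k : nat) :
  (k < n)%N ->
  n`!%:R * ((n - k)%N%:R * dexp lam (n - k)%N * (dbell_gf lam k).[x]) =
  n%:R * ('C(n.-1, k)%:R * (dbell lam k).[x] * dffact lam 1 (n - k)%N).
Proof.
case: n => // n; rewrite ltnS => lekn; rewrite -dexp_fact subSn // /=.
rewrite /dbell hornerZ !factS -(bin_fact lekn) !natrM; ring.
Qed.

Theorem theorem2 (R : realType) (lam : R) (n : nat) (x : R) (hx : x != 0) :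
  x^-1 * (dbell lam n.+1).[x] =
    derive1 (fun y : R => (dbell lam n).[y]) x + (dbell lam n).[x]
    - n%:R * lam *
      \sum_(0 <= k < n) 'C(n.-1, k)%:R * (dbell lam k).[x] * dffact lam 1 (n - k).
Proof.
have -> : derive1 (fun y : R => (dbell lam n).[y]) x = (dbell lam n)^`().[x].
  by rewrite derivE.
have -> : x^-1 * (dbell lam n.+1).[x] = n`!%:R *
    \sum_(i < n.+1) (dexp lam i.+1 *+ i.+1) * (dbell_gf lam (n - i)%N).[x].
  rewrite /dbell factS mulnC natrM -scalerA [n.+1%:R *: _]scaler_nat dbell_gf_deriv_t.
  rewrite hornerZ hornerM hornerX mulrCA mulKf // horner_sum.
  by congr (_ * _); apply: eq_bigr => i _; rewrite hornerZ.
rewrite -hornerD {1 2}/dbell derivZ -scalerDr dbell_gf_deriv_x hornerZ.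
rewrite horner_sum.
(* Splits e_lam' into e_lam - lam t e_lam'; the e_lam part is exactly dF/dx + F. *)
under eq_bigr => i _ do rewrite dexp_ode mulrBl -hornerZ.
rewrite sumrB mulrBr; congr (_ - _).
(* The series t e_lam' has no constant term, so n summands remain; reversing them puts k in place of
   n - i. *)
rewrite big_ord_recl /= !mul0r add0r.
rewrite big_mkord (reindex_inj rev_ord_inj) !mulr_sumr.
apply: eq_bigr => k _ /=.
rewrite /bump /= add1n subnSK // subKn; last exact: ltnW.
by rewrite [n%:R * lam]mulrC -[RHS]mulrA -dexp_dbell_coef //; ring.
Qed.
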